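(* Given an arbitrary $\bm X\in\mathbb{R}^{D\times N}$, the mean-pooling, the max-pooling, and the attention-pooling with attention weights $\bm a_{\bm X}$ can be equivalently achieved by the regularized optimal transport pooling operation $f_{\mathrm{rot}}(\bm X;\bm\theta)$ defined in the context, $\bm\theta=\{\alpha_0,\alpha_1,\alpha_2,\alpha_3,\bm p_0,\bm q_0\}$, under the following configurations: 1. Mean-pooling: $\alpha_0=0$, $\alpha_1\to\infty$, $\alpha_2\to\infty$, $\alpha_3\to\infty$, $\bm p_0=\frac1D\bm 1_D$, $\bm q_0=\frac1N\bm 1_N$. 2. Max-pooling: $\alpha_0=0$, $\alpha_1=0$, $\alpha_2\to\infty$, $\alpha_3=0$, $\bm p_0=\frac1D\bm 1_D$, and $\bm q_0$ can be an arbitrary vector. 3. Attention-pooling: $\alpha_0=0$, $\alpha_1\to\infty$, $\alpha_2\to\infty$, $\alpha_3\to\infty$, $\bm p_0=\frac1D\bm 1_D$, $\bm q_0=\bm a_{\bm X}$. Here, $\alpha_2,\alpha_3\to\infty$ means that the corresponding marginal prior regularizers become strict marginal constraints ($\bm P\bm 1_N=\bm p_0$ for $\alpha_2$, $\bm P^T\bm 1_D=\bm q_0$ for $\alpha_3$), and $\alpha_1\to\infty$ means that the smoothness regularizer $\mathrm{R}$ is dominant and thus the optimal transport term $\langle-\bm X,\bm P\rangle$ becomes ignorable.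
   Context: Notation. $\bm x_n$ is the $n$-th column of $\bm X=[x_{dn}]\in\mathbb{R}^{D\times N}$; $\bm 1_N$ is the all-one vector in $\mathbb{R}^N$; $\Delta^{n-1}$ is the probability simplex in $\mathbb{R}^n$; $\langle\cdot,\cdot\rangle$ is the inner product of matrices (or vectors); $\odot$ is the entrywise product; $\mathrm{diag}(\bm v)$ is the diagonal matrix with diagonal $\bm v$ and $\mathrm{diag}^{-1}(\bm v)$ its inverse. Pooling operations to be reproduced (each maps $\bm X$ to a vector in $\mathbb{R}^D$). Mean-pooling: $\frac1N\sum_{n=1}^N\bm x_n$. Max-pooling: the vector whose $d$-th entry is $\max_{n}x_{dn}$. Attention-pooling with attention weights $\bm a_{\bm X}\in\Delta^{N-1}$: $\bm X\bm a_{\bm X}$, where $\bm a_{\bm X}$ is derived from $\bm X$ by a self-attention mechanism, $\bm a_{\bm X}=\mathrm{softmax}(\bm w^T\tanh(\bm V\bm X))^T$. $\mathrm{KL}(\bm a|\bm b)=\langle\bm a,\log\bm a-\log\bm b\rangle-\langle\bm a-\bm b,\bm 1\rangle$. For $\bm X\in\mathbb{R}^{D\times N}$ put $\bm\mu_1=\frac1N\bm X\bm 1_N$, $\bm\mu_2=\frac1D\bm X^T\bm 1_D$, $\bm\Sigma_1=\frac1N(\bm X-\bm\mu_1\bm 1_N^T)(\bm X-\bm\mu_1\bm 1_N^T)^T$, $\bm\Sigma_2=\frac1D(\bm X-\bm 1_D\bm\mu_2^T)^T(\bm X-\bm 1_D\bm\mu_2^T)$, and $C(\bm X,\bm P)=-\bm\Sigma_1\bm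 P\bm\Sigma_2^T$. Regularized optimal transport (ROT) problem. With $\Omega=\{\bm P\in\mathbb{R}^{D\times N}\mid\bm P>\bm 0,\ \bm 1_D^T\bm P\bm 1_N=1\}$, $$\bm P^*_{\mathrm{rot}}(\bm X;\bm\theta)=\arg\min_{\bm P\in\Omega}\ \langle-\bm X,\bm P\rangle+\alpha_0\langle C(\bm X,\bm P),\bm P\rangle+\alpha_1\mathrm{R}(\bm P)+\alpha_2\mathrm{KL}(\bm P\bm 1_N|\bm p_0)+\alpha_3\mathrm{KL}(\bm P^T\bm 1_D|\bm q_0),$$ where $\mathrm{R}$ is a regularizer of $\bm P$ used to improve the smoothness of the objective function; typically $\mathrm{R}$ is the negative entropy $\mathrm{R}(\bm P)=\sum_{d,n}p_{dn}(\log p_{dn}-1)$ or the quadratic regularizer $\mathrm{R}(\bm P)=\|\bm P\|_F^2$. Pooling operation: $$f_{\mathrm{rot}}(\bm X;\bm\theta)=\big(\bm X\odot(\mathrm{diag}^{-1}(\bm P^*\bm 1_N)\,\bm P^* )\big)\bm 1_N\in\mathbb{R}^D,\qquad \bm P^*=\bm P^*_{\mathrm{rot}}(\bm X;\bm\theta).$$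
   Formalization: For max-pooling the minimum is taken over the closure of the feasible set (zero entries allowed), since over P > 0 it is generally not attained; any minimizer with P > 0 also gives max-pooling. R is the negative entropy or the quadratic regularizer, since the claim fails for an arbitrary R. *)

(* Defs.v *)
From HB Require Import structures.
From mathcomp Require Import all_boot all_order all_algebra.
From mathcomp Require Import all_classical all_reals all_analysis.
Set Implicit Arguments.
Unset Strict Implicit.
Unset Printing Implicit Defensive.
Import Order.TTheory GRing.Theory Num.Theory.
Import numFieldNormedType.Exports.
Local Open Scope classical_set_scope.
Local Open Scope ring_scope.

Definition ones {R : realType} (n : nat) : 'cV[R]_n := const_mx 1.

Definition inner {R : realType} (m n : nat) (A B : 'M[R]_(m, n)) : R :=
  \sum_(i < m) \sum_(j < n) A i j * B i j.

(* [ln 0 = 0] in the library, so [x * ln x] is extended continuously to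
   [x = 0]. *)
Definition KL {R : realType} (n : nat) (a b : 'cV[R]_n) : R :=
  inner a (map_mx (@ln R) a - map_mx (@ln R) b) - inner (a - b) (ones n).

Definition neg_entropy {R : realType} (D N : nat) (P : 'M[R]_(D, N)) : R :=
  \sum_(d < D) \sum_(n < N) P d n * (ln (P d n) - 1).

Definition sq_frobenius {R : realType} (D N : nat) (P : 'M[R]_(D, N)) : R :=
  \sum_(d < D) \sum_(n < N) P d n ^+ 2.

Section Structure.
Variables (R : realType) (D N : nat) (X : 'M[R]_(D, N)).

Definition mu1 : 'cV[R]_D := N%:R^-1 *: (X *m ones N).

Definition mu2 : 'cV[R]_N := D%:R^-1 *: (X^T *m ones D).

Definition Sigma1 : 'M[R]_D :=
  let Y := X - mu1 *m (ones N)^T in N%:R^-1 *: (Y *m Y^T).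

Definition Sigma2 : 'M[R]_N :=
  let Y := X - ones D *m mu2^T in D%:R^-1 *: (Y^T *m Y).

Definition structural_cost (P : 'M[R]_(D, N)) : 'M[R]_(D, N) :=
  - (Sigma1 *m P *m Sigma2^T).

End Structure.

(* The weights [alpha1], [alpha2], [alpha3] may take the value [+oo], which
   stands for the configurations "alpha_i tends to infinity". *)
Record rot_param (R : realType) (D N : nat) := RotParam {
  alpha0 : R;
  alpha1 : \bar R;
  alpha2 : \bar R;
  alpha3 : \bar R;
  prior_p : 'cV[R]_D;
  prior_q : 'cV[R]_N }.

Definition Omega {R : realType} (D N : nat) : set 'M[R]_(D, N) :=
  [set P : 'M[R]_(D, N) | (forall d n, 0 < P d n) /\ (ones D)^T *m P *m ones N = 1%:M].

Section ROT.
Variables (R : realType) (D N : nat).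
Variables (reg : 'M[R]_(D, N) -> R) (X : 'M[R]_(D, N)).
Variable theta : rot_param R D N.

(* An infinite weight on a KL term is the strict marginal constraint. *)
Definition rot_feasible : set 'M[R]_(D, N) :=
  [set P : 'M[R]_(D, N) | [/\ Omega P,
               alpha2 theta = +oo%E -> P *m ones N = prior_p theta &
               alpha3 theta = +oo%E -> P^T *m ones D = prior_q theta]].

(* When [alpha1 = +oo] the regularizer is dominant: the terms of finite weight
   are ignored. A KL term of infinite weight has been turned into a constraint,
   under which it vanishes; it does not contribute since [fine +oo = 0]. *)
Definition rot_objective (P : 'M[R]_(D, N)) : R :=
  if alpha1 theta == +oo%E then reg P
  else inner (- X) P
       + alpha0 theta * inner (structural_cost X P) P
       + fine (alpha1 theta) * reg P
       + fine (alpha2 theta) * KL (P *m ones N) (prior_p theta)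
       + fine (alpha3 theta) * KL (P^T *m ones D) (prior_q theta).

Definition argmin_on (F : set 'M[R]_(D, N)) (J : 'M[R]_(D, N) -> R) :
    set 'M[R]_(D, N) :=
  [set P | F P /\ forall Q, F Q -> J P <= J Q].

Definition rot_plans : set 'M[R]_(D, N) :=
  argmin_on rot_feasible rot_objective.

(* The feasible set requires positive entries and so is not closed: without a
   smoothness regularizer the infimum is in general attained only on its
   closure, by plans with zero entries. *)
Definition rot_plans_closure : set 'M[R]_(D, N) :=
  argmin_on (closure rot_feasible) rot_objective.

(* The diagonal matrix is invertible whenever the row sums of [P] are nonzero, in
   particular on [Omega]; [invmx] is a junk value otherwise. *)
Definition rot_pool (P : 'M[R]_(D, N)) : 'cV[R]_D :=
  map2_mx *%R X (invmx (diag_mx (P *m ones N)^T) *m P) *m ones N.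

(* Minimizers need not be unique, so the pooling operation is the set of values
   taken at all the minimizers. [f_rot reg X theta = [set v]] means that a
   minimizer exists and that every minimizer yields [v]. *)
Definition f_rot : set 'cV[R]_D := rot_pool @` rot_plans.

Definition f_rot_closure : set 'cV[R]_D := rot_pool @` rot_plans_closure.

End ROT.

Definition mean_pool {R : realType} (D N : nat) (X : 'M[R]_(D, N)) : 'cV[R]_D :=
  N%:R^-1 *: \sum_(n < N) col n X.

Definition max_pool {R : realType} (D N : nat) (X : 'M[R]_(D, N.+1)) :
    'cV[R]_D :=
  \col_(d < D) \big[Num.max/X d ord0]_(n < N.+1) X d n.

Definition tanh {R : realType} (x : R) : R :=
  (expR x - expR (- x)) / (expR x + expR (- x)).

Definition softmax {R : realType} (n : nat) (z : 'rV[R]_n) : 'rV[R]_n :=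
  \row_(j < n) (expR (z 0 j) / \sum_(k < n) expR (z 0 k)).

Definition attention_weights {R : realType} (K D N : nat)
    (w : 'cV[R]_K) (V : 'M[R]_(K, D)) (X : 'M[R]_(D, N)) : 'cV[R]_N :=
  (softmax (w^T *m map_mx tanh (V *m X)))^T.

Definition attention_pool {R : realType} (K D N : nat)
    (w : 'cV[R]_K) (V : 'M[R]_(K, D)) (X : 'M[R]_(D, N)) : 'cV[R]_D :=
  X *m attention_weights w V X.

Definition mean_config {R : realType} (D N : nat) : rot_param R D N :=
  RotParam 0 +oo%E +oo%E +oo%E (D%:R^-1 *: ones D) (N%:R^-1 *: ones N).

Definition max_config {R : realType} (D N : nat) (q0 : 'cV[R]_N) :
    rot_param R D N :=
  RotParam 0 0%E +oo%E 0%E (D%:R^-1 *: ones D) q0.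

Definition attention_config {R : realType} (K D N : nat)
    (w : 'cV[R]_K) (V : 'M[R]_(K, D)) (X : 'M[R]_(D, N)) : rot_param R D N :=
  RotParam 0 +oo%E +oo%E +oo%E (D%:R^-1 *: ones D) (attention_weights w V X).

(* Main.v *)
Require Import Defs.
From HB Require Import structures.
From mathcomp Require Import all_boot all_order all_algebra.
From mathcomp Require Import ring.
From mathcomp Require Import all_classical all_reals all_analysis.
Set Implicit Arguments.
Unset Strict Implicit.
Unset Printing Implicit Defensive.
Import Order.TTheory GRing.Theory Num.Theory.
Import numFieldNormedType.Exports.
Local Open Scope classical_set_scope.
Local Open Scope ring_scope.

(** When the row marginal of a plan [P] is uniform, [rot_pool X P] has entries
    [D * \sum_n X d n * P d n].

    Mean- and attention-pooling: both regularizers are sums of a strictly convex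
    function over the entries, and the rank-one plan [D^-1 * q n] has entries
    depending only on the column. Summing the tangent inequalities at these
    entries, the linear terms cancel by the constraint on the column marginal, so
    the rank-one plan is the unique minimizer, and it pools to [X *m q].

    Max-pooling: the objective is minus the mean of the pooled entries, each of
    which is at most the maximum of its row. The bound is attained by the plan
    concentrated on row maxima, a limit of feasible plans, hence every minimizer
    pools to the row maxima. *)

(** * Strict tangent inequalities for the two regularizers *)

Lemma leif_tangent_entropy (R : realType) (x y : R) : 0 <= x -> 0 < y ->
  y * (ln y - 1) + ln y * (x - y) <= x * (ln x - 1) ?= iff (x == y).
Proof.
rewrite le_eqVlt => /predU1P[<- y0|x0 y0].
  (* At [x = 0] the tangent at [y] takes the value [- y], which is negative. *)
  rewrite (_ : _ + _ = - y); last by ring.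
  by rewrite mul0r; apply/leifP; rewrite lt_eqF ?oppr_lt0.
have [<-|xy] := eqVneq x y.
  by rewrite subrr mulr0 addr0; apply/leifP.
apply/leifP.
have yx : ln (y / x) = ln y - ln x by rewrite ln_div.
have nz : ln (y / x) != 0.
  rewrite yx subr_eq0; apply: contra xy => /eqP/ln_inj ->//.
(* The claim is [1 + u < expR u] at [u = ln (y / x)], multiplied by [x]. *)
have := expR_gt1Dx nz; rewrite lnK ?posrE ?divr_gt0// yx ltr_pdivlMr// => h.
by rewrite -subr_gt0; move: h; rewrite -subr_gt0; congr (0 < _); ring.
Qed.

Lemma leif_tangent_sqr (R : realType) (x y : R) :
  y ^+ 2 + y *+ 2 * (x - y) <= x ^+ 2 ?= iff (x == y).
Proof.
have e : x ^+ 2 - (y ^+ 2 + y *+ 2 * (x - y)) = (x - y) ^+ 2 by ring.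
split; first by rewrite -subr_ge0 e sqr_ge0.
by rewrite eq_sym -subr_eq0 e sqrf_eq0 subr_eq0.
Qed.

(** * Marginals, pooling of plans with uniform rows, and closed constraints *)

Section Marginals.
Variable R : realType.

Lemma mulmx_ones D N (P : 'M[R]_(D, N)) :
  P *m ones N = \col_d \sum_n P d n.
Proof. by apply/colP => d; rewrite !mxE; apply: eq_bigr => n _; rewrite mxE mulr1. Qed.

Lemma row_sumsP D N (P : 'M[R]_(D, N)) (p : 'cV[R]_D) :
  P *m ones N = p <-> forall d, \sum_n P d n = p d 0.
Proof.
rewrite mulmx_ones; split => [<- d|h]; first by rewrite mxE.
by apply/colP => d; rewrite mxE h.
Qed.

Lemma col_sumsP D N (P : 'M[R]_(D, N)) (q : 'cV[R]_N) :
  P^T *m ones D = q <-> forall n, \sum_d P d n = q n 0.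
Proof.
rewrite row_sumsP; split => h n; rewrite -h; by apply: eq_bigr => d _; rewrite mxE.
Qed.

Lemma Omega_uniform D N (P : 'M[R]_(D.+1, N)) :
  (forall d n, 0 < P d n) -> P *m ones N = D.+1%:R^-1 *: ones D.+1 -> Omega P.
Proof.
move=> P0 P1; split => //.
rewrite -mulmxA P1 -scalemxAr mulmx_ones.
apply/matrixP => i j; rewrite !ord1 !mxE.
under eq_bigr do rewrite !mxE.
by rewrite sumr_const card_ord mulVf ?pnatr_eq0.
Qed.

Lemma rot_pool_uniform D N (X P : 'M[R]_(D.+1, N)) :
  P *m ones N = D.+1%:R^-1 *: ones D.+1 ->
  rot_pool X P = \col_d (D.+1%:R * \sum_n X d n * P d n).
Proof.
move=> P1; rewrite /rot_pool P1.
rewrite (_ : diag_mx _ = (D.+1%:R^-1)%:M); last first.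
  by apply/matrixP => i j; rewrite !mxE mulr1.
rewrite invmx_scalar invrK mul_scalar_mx mulmx_ones.
apply/colP => d; rewrite !mxE mulr_sumr; apply: eq_bigr => n _.
by rewrite !mxE mulrCA.
Qed.

Lemma closure_sub_preimage (T U : topologicalType) (f : T -> U) (A : set T) (C : set U) :
  continuous f -> closed C -> A `<=` f @^-1` C -> closure A `<=` f @^-1` C.
Proof.
move=> cf cC AC; rewrite [X in _ `<=` X](_ : _ = closure (f @^-1` C)).
  exact: closureS.
by apply/closure_id; apply: closed_comp => // x _; apply: cf.
Qed.

Lemma continuous_inner D N (X : 'M[R]_(D, N)) : continuous (inner X).
Proof.
move=> Q; apply: (@cvg_big _ _ _ _ _ _ _ (nbhs Q)) => [|d _]; first exact: add_continuous.
apply: (@cvg_big _ _ _ _ _ _ _ (nbhs Q)) => [|n _]; first exact: add_continuous.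
by apply: cvgM; [exact: cvg_cst|exact: coord_continuous].
Qed.

(** Each condition is a closed condition on a continuous function of the entries, so it passes to
    the closure; strict positivity only survives as nonnegativity. *)
Lemma closure_rot_feasible_sub D N (theta : rot_param R D N) P :
  closure (rot_feasible theta) P ->
  [/\ forall d n, 0 <= P d n,
      alpha2 theta = +oo%E -> P *m ones N = prior_p theta &
      alpha3 theta = +oo%E -> P^T *m ones D = prior_q theta].
Proof.
(* Row and column sums are both covered, by taking [i] or [j] constant. *)
have csum (I : finType) (i : I -> 'I_D) (j : I -> 'I_N) :
    continuous (fun Q : 'M[R]_(D, N) => \sum_k Q (i k) (j k)).
  move=> Q; apply: (@cvg_big _ _ _ _ _ _ _ (nbhs Q)) => [|k _].
    exact: add_continuous.
  exact: (@coord_continuous R _ _ (i k) (j k) Q).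
move=> FP.
have key (f : 'M[R]_(D, N) -> R) (C : set R) : continuous f -> closed C ->
    rot_feasible theta `<=` f @^-1` C -> C (f P).
  by move=> cf cC FC; exact: (closure_sub_preimage cf cC FC FP).
split.
- move=> d n; apply: (key (fun Q => Q d n) [set x | 0 <= x]).
  + exact: coord_continuous.
  + exact: closed_ge.
  + by move=> Q [[Q0 _] _ _]; exact/ltW/Q0.
- move=> a2; apply/row_sumsP => d.
  apply: (key (fun Q => \sum_n Q d n) [set x | x = prior_p theta d 0]).
  + exact: (csum _ (fun=> d) id).
  + exact: closed_eq.
  + by move=> Q [_ /(_ a2)/row_sumsP h _]; exact: h.
- move=> a3; apply/col_sumsP => n.
  apply: (key (fun Q => \sum_d Q d n) [set x | x = prior_q theta n 0]).
  + exact: (csum _ id (fun=> n)).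
  + exact: closed_eq.
  + by move=> Q [_ _ /(_ a3)/col_sumsP h]; exact: h.
Qed.

End Marginals.

(** * Dominant regularizer, for mean- and attention-pooling *)

Section DominantRegularizer.
Variables (R : realType) (D N : nat).
Variables (reg : 'M[R]_(D.+1, N.+1) -> R) (X : 'M[R]_(D.+1, N.+1)).
Hypothesis hreg : reg = @neg_entropy R D.+1 N.+1 \/ reg = @sq_frobenius R D.+1 N.+1.
Variable q : 'cV[R]_N.+1.
Hypothesis q_gt0 : forall n, 0 < q n 0.
Hypothesis q_sum : \sum_n q n 0 = 1.

(** The independent coupling of the uniform distribution on rows with [q]. *)
Definition product_plan : 'M[R]_(D.+1, N.+1) := \matrix_(d, n) (D.+1%:R^-1 * q n 0).

Lemma product_plan_gt0 d n : 0 < product_plan d n.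
Proof. by rewrite mxE mulr_gt0 ?invr_gt0 ?ltr0n. Qed.

Lemma product_plan_row : product_plan *m ones N.+1 = D.+1%:R^-1 *: ones D.+1.
Proof.
apply/row_sumsP => d; rewrite !mxE mulr1.
under eq_bigr do rewrite mxE.
by rewrite -mulr_sumr q_sum mulr1.
Qed.

Lemma product_plan_col n : \sum_d product_plan d n = q n 0.
Proof.
under eq_bigr do rewrite mxE.
by rewrite sumr_const card_ord -(mulr_natl (_ * _)) mulVKf ?pnatr_eq0 //.
Qed.

(* The slopes of the tangents to the regularizer at [product_plan] depend only on the column,
   so their total contribution is determined by the column marginal. *)
Lemma product_plan_leif (P : 'M[R]_(D.+1, N.+1)) : (forall d n, 0 <= P d n) -> P^T *m ones D.+1 = q ->
  reg product_plan <= reg P ?= iff (P == product_plan).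
Proof.
move=> P0 /col_sumsP Pq.
have gen (phi : R -> R) (g : 'I_N.+1 -> R) :
  (forall d n, phi (product_plan d n) + g n * (P d n - product_plan d n)
     <= phi (P d n) ?= iff (P d n == product_plan d n)) ->
  \sum_d \sum_n phi (product_plan d n) <= \sum_d \sum_n phi (P d n)
    ?= iff (P == product_plan).
  move=> h.
  have -> : (P == product_plan) =
      [forall d, [forall n, P d n == product_plan d n]].
    apply/eqP/'forall_forallP => [-> //|e]; by apply/matrixP => d n; apply/eqP.
  have -> : \sum_d \sum_n phi (product_plan d n) =
     \sum_d \sum_n (phi (product_plan d n) + g n * (P d n - product_plan d n)).
    under [RHS]eq_bigr do rewrite big_split /=.
    rewrite big_split /= [X in _ = _ + X]exchange_big /=.
    rewrite [X in _ = _ + X]big1 ?addr0// => n _.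
    by rewrite -mulr_sumr sumrB Pq product_plan_col subrr mulr0.
  by apply: leif_sum => d _; apply: leif_sum => n _.
case: hreg => ->.
- apply: (gen (fun x => x * (ln x - 1)) (fun n => ln (D.+1%:R^-1 * q n 0))) => d n.
  have := leif_tangent_entropy (P0 d n) (product_plan_gt0 d n).
  (* Only the occurrence in the slope is unfolded, to show that it depends on [n] alone. *)
  by rewrite {3}/product_plan mxE.
- apply: (gen (fun x => x ^+ 2) (fun n => (D.+1%:R^-1 * q n 0) *+ 2)) => d n.
  have := leif_tangent_sqr (P d n) (product_plan d n).
  by rewrite {2}/product_plan mxE.
Qed.

Let theta := RotParam 0 +oo%E +oo%E +oo%E (D.+1%:R^-1 *: ones D.+1) q.

Lemma product_plan_feasible : rot_feasible theta product_plan.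
Proof.
split=> [|_|_] /=.
- by apply: Omega_uniform; [exact: product_plan_gt0|exact: product_plan_row].
- exact: product_plan_row.
- by apply/col_sumsP; exact: product_plan_col.
Qed.

(** Keeping [F] abstract treats the feasible set and its closure at once: uniqueness rests on
    nonnegativity and the column marginal, which hold on the closure. *)
Lemma argmin_dominant F : F product_plan -> F `<=` closure (rot_feasible theta) ->
  argmin_on F (rot_objective reg X theta) = [set product_plan].
Proof.
move=> FP FC; rewrite /rot_objective /=.
have leF P : F P -> reg product_plan <= reg P ?= iff (P == product_plan).
  move=> /FC/closure_rot_feasible_sub[P0 _ /(_ erefl)]; exact: product_plan_leif.
apply/seteqP; split => [P [/= HP /(_ _ FP) leP]|P ->] /=.
- by apply/eqP; rewrite -(leF P HP).2 eq_le leP (leF P HP).1.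
- by split => // Q /leF [].
Qed.

Lemma rot_pool_product_plan : rot_pool X product_plan = X *m q.
Proof.
rewrite rot_pool_uniform ?product_plan_row//; apply/colP => d; rewrite !mxE mulr_sumr.
by apply: eq_bigr => n _; rewrite mxE mulrCA mulVKf ?pnatr_eq0.
Qed.

Lemma f_rot_dominant : f_rot reg X theta = [set X *m q].
Proof.
rewrite /f_rot /rot_plans argmin_dominant ?image_set1 ?rot_pool_product_plan//.
- exact: product_plan_feasible.
- exact: subset_closure.
Qed.

Lemma f_rot_closure_dominant : f_rot_closure reg X theta = [set X *m q].
Proof.
rewrite /f_rot_closure /rot_plans_closure argmin_dominant ?image_set1 ?rot_pool_product_plan//.
exact/subset_closure/product_plan_feasible.
Qed.

End DominantRegularizer.

Section UniformWeights.
Variables (R : realType) (N : nat).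

(** Serves as the column marginal for mean-pooling and as a positive perturbation for
    max-pooling. *)
Definition uniform_weights : 'cV[R]_N.+1 := N.+1%:R^-1 *: ones N.+1.

Lemma uniform_weights_gt0 n : 0 < uniform_weights n 0.
Proof. by rewrite !mxE mulr1 invr_gt0 ltr0n. Qed.

Lemma sum_uniform_weights : \sum_n uniform_weights n 0 = 1.
Proof.
under eq_bigr do rewrite !mxE mulr1.
by rewrite sumr_const card_ord -(mulr_natl _^-1) mulfV ?pnatr_eq0.
Qed.

End UniformWeights.

(** * Max-pooling as a linear program *)

Section MaxPooling.
Variables (R : realType) (D N : nat).
Variables (reg : 'M[R]_(D.+1, N.+1) -> R) (X : 'M[R]_(D.+1, N.+1)).
Variable q0 : 'cV[R]_N.+1.

Let theta := max_config D.+1 q0.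
Let F := rot_feasible theta.

Lemma max_config_feasible (P : 'M[R]_(D.+1, N.+1)) : (forall d n, 0 < P d n) ->
  P *m ones N.+1 = D.+1%:R^-1 *: ones D.+1 -> F P.
Proof. by move=> P0 P1; split => //; exact: Omega_uniform. Qed.

Lemma max_config_objective P : rot_objective reg X theta P = - inner X P.
Proof.
(* Since [fine +oo = 0], the KL term of [alpha2] vanishes along with the terms of zero weight. *)
rewrite /rot_objective /= !mul0r !addr0 /inner -sumrN; apply: eq_bigr => d _.
by rewrite -sumrN; apply: eq_bigr => n _; rewrite mxE mulNr.
Qed.

Definition row_argmax d : 'I_N.+1 := [arg max_(n > ord0) X d n]%O.

Lemma row_argmaxP d n : X d n <= X d (row_argmax d).
Proof. by rewrite /row_argmax; case: arg_maxP => // i _; exact. Qed.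

Lemma max_poolE d : max_pool X d 0 = X d (row_argmax d).
Proof.
rewrite mxE; apply/eqP; rewrite eq_le le_bigmax andbT.
by apply/bigmax_leP; split => [|n _]; exact: row_argmaxP.
Qed.

Definition argmax_plan : 'M[R]_(D.+1, N.+1) :=
  \matrix_(d, n) (if n == row_argmax d then D.+1%:R^-1 else 0).

Lemma argmax_plan_row : argmax_plan *m ones N.+1 = D.+1%:R^-1 *: ones D.+1.
Proof.
apply/row_sumsP => d; rewrite !mxE mulr1.
by under eq_bigr do rewrite mxE; rewrite -big_mkcond big_pred1_eq.
Qed.

Lemma inner_argmax_plan : inner X argmax_plan = \sum_d max_pool X d 0 / D.+1%:R.
Proof.
apply: eq_bigr => d _; rewrite max_poolE (bigD1 (row_argmax d)) //= big1 ?addr0.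
  by rewrite mxE eqxx.
by move=> n /negPf nd; rewrite mxE nd mulr0.
Qed.

(** A row of mass [D.+1%:R^-1] contributes at most that share of its maximum. Equality is expressed
    through the pooled vector because ties within a row allow several optimal plans. *)
Lemma inner_leif_max_pool (P : 'M[R]_(D.+1, N.+1)) : (forall d n, 0 <= P d n) ->
  P *m ones N.+1 = D.+1%:R^-1 *: ones D.+1 ->
  inner X P <= \sum_d max_pool X d 0 / D.+1%:R ?= iff (rot_pool X P == max_pool X).
Proof.
move=> P0 P1; rewrite rot_pool_uniform//.
have -> : (\col_d (D.+1%:R * \sum_n X d n * P d n) == max_pool X) =
    [forall d, \sum_n X d n * P d n == max_pool X d 0 / D.+1%:R].
  apply/eqP/forallP => [<- d|h].
    by rewrite mxE mulrAC mulfV ?mul1r ?pnatr_eq0.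
  by apply/colP => d; rewrite !mxE (eqP (h d)) mulrCA mulfV ?mulr1 ?pnatr_eq0 // mxE.
apply: leif_sum => d _; split => //; rewrite max_poolE.
move/row_sumsP/(_ d): P1; rewrite !mxE mulr1 => <-; rewrite mulr_sumr.
by apply: ler_sum => n _; rewrite ler_wpM2r ?row_argmaxP.
Qed.

(* [argmax_plan] has zero entries; mixing in a little of the uniform plan makes it feasible. *)
Lemma argmax_plan_closure : closure F argmax_plan.
Proof.
have q_gt0 := @uniform_weights_gt0 R N.
have q_sum := @sum_uniform_weights R N.
set q := uniform_weights R N in q_gt0 q_sum *.
pose mix t := argmax_plan + t *: (product_plan D q - argmax_plan).
have Fmix t : 0 < t < 1 -> F (mix t).
  move=> /andP[t0 t1]; apply: max_config_feasible.
    move=> d n; rewrite (_ : mix t d n =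
        (1 - t) * argmax_plan d n + t * product_plan D q d n); last first.
      by rewrite !mxE; ring.
    apply: ltr_wpDl; last by rewrite mulr_gt0// product_plan_gt0.
    rewrite mulr_ge0 ?subr_ge0 ?(ltW t1)// mxE.
    by case: ifP.
  by rewrite mulmxDl -scalemxAl mulmxBl argmax_plan_row product_plan_row// subrr scaler0 addr0.
(* The limit is taken from the right because the uniform part is positive only for [t > 0]. *)
have mix_cvg : mix t @[t --> 0^'+] --> argmax_plan.
  have -> : argmax_plan = argmax_plan + 0 *: (product_plan D q - argmax_plan).
    by rewrite scale0r addr0.
  apply: cvgD; first exact: cvg_cst.
  by apply: cvgZ; [exact/cvg_at_right_filter/cvg_id|exact: cvg_cst].
move=> B /mix_cvg nB.
have [t [Bt t01]] : exists t, B (mix t) /\ 0 < t < 1.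
  apply: (@filter_ex _ (0^'+ : set_system R)).
  near=> t; split; near: t; first exact: nB.
  near=> t; apply/andP; split; near: t.
    exact: nbhs_right_gt.
  exact: nbhs_right_lt.
by exists (mix t); split => //; exact: Fmix.
Unshelve. all: by end_near. Qed.

(** Membership in the closure and comparison with feasible plans only are common to the minimizers
    of both problems. Continuity of [inner X] extends the comparison to [argmax_plan], which forces
    equality in the upper bound. *)
Lemma rot_pool_max P : closure F P ->
  (forall Q, F Q -> rot_objective reg X theta P <= rot_objective reg X theta Q) ->
  rot_pool X P = max_pool X.
Proof.
move=> /closure_rot_feasible_sub[P0 /(_ erefl) P1 _] leP.
have ub := inner_leif_max_pool P0 P1.
apply/eqP; rewrite -ub.2 eq_le ub.1 -inner_argmax_plan.
have FC : F `<=` inner X @^-1` [set x | x <= inner X P].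
  by move=> Q /leP; rewrite !max_config_objective lerN2.
exact: (closure_sub_preimage (@continuous_inner _ _ _ X) (@closed_le _ _) FC argmax_plan_closure).
Qed.

Lemma argmax_plan_pool : rot_pool X argmax_plan = max_pool X.
Proof.
have [P0 /(_ erefl) P1 _] := closure_rot_feasible_sub argmax_plan_closure.
by apply/eqP; rewrite -(inner_leif_max_pool P0 P1).2 inner_argmax_plan.
Qed.

Lemma argmax_plan_optimal : rot_plans_closure reg X theta argmax_plan.
Proof.
split; first exact: argmax_plan_closure.
move=> Q /closure_rot_feasible_sub[Q0 /(_ erefl) Q1 _].
rewrite !max_config_objective lerN2 inner_argmax_plan.
exact: (inner_leif_max_pool Q0 Q1).1.
Qed.

(** Only an inclusion: if some row of [X] is not constant, positive plans stay strictly above the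
    infimum and the left side is empty. *)
Lemma f_rot_max : f_rot reg X theta `<=` [set max_pool X].
Proof.
by move=> _ [P [FP leP] <-]; apply: rot_pool_max leP; exact: subset_closure.
Qed.

Lemma f_rot_closure_max : f_rot_closure reg X theta = [set max_pool X].
Proof.
apply/seteqP; split => [_ [P [FP leP] <-]|_ ->].
  by apply: rot_pool_max FP _ => Q FQ; apply/leP/subset_closure.
by exists argmax_plan; [exact: argmax_plan_optimal|exact: argmax_plan_pool].
Qed.

End MaxPooling.

(** * Softmax weights as a positive probability vector *)

Lemma softmax_gt0 (R : realType) n (z : 'rV[R]_n.+1) j : 0 < softmax z 0 j.
Proof.
rewrite mxE divr_gt0 ?expR_gt0// (bigD1 j)//= ltr_pwDl ?expR_gt0//.
by apply: sumr_ge0 => k _; exact: expR_ge0.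
Qed.

Lemma sum_softmax (R : realType) n (z : 'rV[R]_n.+1) : \sum_j softmax z 0 j = 1.
Proof.
under eq_bigr do rewrite mxE.
rewrite -mulr_suml mulfV// gt_eqF// (bigD1 ord0)//= ltr_pwDl ?expR_gt0//.
by apply: sumr_ge0 => k _; exact: expR_ge0.
Qed.

Theorem proposition1 (R : realType) (D N : nat) (X : 'M[R]_(D.+1, N.+1))
    (reg : 'M[R]_(D.+1, N.+1) -> R)
    (hreg : reg = @neg_entropy R D.+1 N.+1 \/ reg = @sq_frobenius R D.+1 N.+1) :
  [/\ f_rot reg X (mean_config D.+1 N.+1) = [set mean_pool X] /\
      f_rot_closure reg X (mean_config D.+1 N.+1) = [set mean_pool X],
      forall q0 : 'cV[R]_N.+1,
        f_rot reg X (max_config D.+1 q0) `<=` [set max_pool X] /\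
        f_rot_closure reg X (max_config D.+1 q0) = [set max_pool X]
    & forall (K : nat) (w : 'cV[R]_K) (V : 'M[R]_(K, D.+1)),
        f_rot reg X (attention_config w V X) = [set attention_pool w V X] /\
        f_rot_closure reg X (attention_config w V X)
          = [set attention_pool w V X]].
Proof.
split.
- have q_gt0 := @uniform_weights_gt0 R N.
  have q_sum := @sum_uniform_weights R N.
  set q := uniform_weights R N in q_gt0 q_sum *.
  (* Mean-pooling is the dominant-regularizer case with uniform [q]. *)
  have -> : mean_pool X = X *m q.
    rewrite /q -scalemxAr mulmx_ones; congr (_ *: _); apply/colP => d.
    by rewrite mxE summxE; apply: eq_bigr => n _; rewrite mxE.
  by split; [exact: f_rot_dominant|exact: f_rot_closure_dominant].
- by move=> q0; split; [exact: f_rot_max|exact: f_rot_closure_max].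
- move=> K w V; set a := attention_weights w V X.
  have a_gt0 n : 0 < a n 0 by rewrite mxE softmax_gt0.
  have a_sum : \sum_n a n 0 = 1.
    by under eq_bigr do rewrite mxE; rewrite sum_softmax.
  by split; [exact: f_rot_dominant|exact: f_rot_closure_dominant].
Qed.
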